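(* Let $K$ be a compact Hausdorff topological space, and let $N\in\mathbb{N}$. If $K'$ is infinite, then $\widehat{\otimes}_{\pi,s,N}C(K)$ has the weak-DD2P.
   Context: $C(K)$ is the Banach space of continuous functions $K\to\mathbb{K}$ ($\mathbb{K}=\mathbb{R}$ or $\mathbb{C}$) with the supremum norm, $K'$ is the set of cluster (accumulation) points of $K$, and $\mathbb{N}=\{1,2,\dots\}$. For a Banach space $X$, write $x^N=x\otimes\cdots\otimes x$ ($N$ times) and let $\otimes^{s,N}X$ be the linear span of $\{x^N:x\in X\}$ in the $N$-fold algebraic tensor product. The $N$-fold projective symmetric tensor product $\widehat{\otimes}_{\pi,s,N}X$ is the completion of $\otimes^{s,N}X$ under the norm $\|u\|=\inf\{\sum_{i=1}^n|\lambda_i|\,\|x_i\|^N:\ u=\sum_{i=1}^n\lambda_ix_i^N,\ n\in\mathbb{N},\ \lambda_i\in\mathbb{K},\ x_i\in X\}$. Its dual is the space of $N$-homogeneous continuous scalar polynomials on $X$ with the sup norm over $B_X$. A Banach space $Z$ with closed unit ball $B_Z$ has the weak-DD2P if for every non-empty relatively weakly open subset $W$ of $B_Z$ there exists $z\in W$ such that $\sup_{y\in V}\|z-y\|=2$ for every relatively weakly open subset $V$ of $B_Z$ with $z\in V$. *)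

(* Defs.v *)
From HB Require Import structures.
From mathcomp Require Import all_boot all_order all_algebra.
From mathcomp Require Import complex.
From mathcomp Require Import all_classical all_reals all_analysis.

Set Implicit Arguments.
Unset Strict Implicit.
Unset Printing Implicit Defensive.

Import Order.TTheory GRing.Theory Num.Theory.
Import numFieldNormedType.Exports.

Local Open Scope classical_set_scope.
Local Open Scope ring_scope.

Variant scalar_kind := RealScalars | ComplexScalars.

(* The norm of a normed module over [F] takes its values in [F] itself; for
   [F = R[i]] these values are nonnegative reals, and on sets of such elements
   [supremum 0] and [infimum 0], taken for the partial order of [R[i]], are the
   usual real ones. *)
Definition scalar_field (R : realType) (k : scalar_kind) : numFieldType :=
  match k with
  | RealScalars => R
  | ComplexScalars => R[i]
  end.

Section scalar_theory.
Context {R : realType} {k : scalar_kind}.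
Local Notation F := (scalar_field R k).

Lemma scalar_supremums_neq0 (A : set F) : A !=set0 ->
  (forall a, A a -> 0 <= a) -> ubound A !=set0 -> supremums A !=set0.
Proof.
case: k A => /= A A0 Age0 [M AM].
  have supA : has_sup A by split => //; exists M.
  exists (sup A); split; first exact: sup_upper_bound.
  by move=> y Ay; apply: ge_sup.
have Are a : A a -> a = (complex.Re a)%:C%C.
  move=> /Age0; case: a => u v; rewrite lecE /= => /andP[/eqP v0 _].
  by rewrite v0.
pose B : set R := [set complex.Re a | a in A].
have supB : has_sup B.
  split; first by case: A0 => a Aa; exists (complex.Re a), a.
  by exists (complex.Re M) => _ [a Aa <-]; have /= := AM a Aa; rewrite lecE => /andP[].
exists (sup B)%:C%C; split.
  move=> a Aa; rewrite (Are a Aa) lecR.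
  by apply: sup_upper_bound => //; exists a.
move=> y Ay; case: A0 => a0 Aa0.
have := Ay a0 Aa0; rewrite lecE (Are _ Aa0) /= => /andP[Imy _].
rewrite lecE /= Imy /=; apply: ge_sup; first by case: supB.
by move=> _ [a Aa <-]; have := Ay a Aa; rewrite lecE => /andP[].
Qed.

Lemma scalar_supremumP (A : set F) : A !=set0 ->
  (forall a, A a -> 0 <= a) -> ubound A !=set0 -> supremums A (supremum 0 A).
Proof.
move=> A0 Age0 uA; have [s sA] := scalar_supremums_neq0 A0 Age0 uA.
rewrite /supremum; case: ifPn => [/eqP AE|_].
  by move: A0; rewrite AE => -[].
by case: xgetP => [y _ //|/(_ s)].
Qed.

End scalar_theory.

Section continuous_functions.
Context {R : realType} (k : scalar_kind) {K : topologicalType}.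
Local Notation F := (scalar_field R k).

Definition cfun_pred : {pred (K -> F^o)} :=
  [pred f : K -> F^o | `[< continuous (f : K -> F) >]].

Lemma cfun_submod_closed : submod_closed cfun_pred.
Proof.
split=> [|a f g /asboolP cf /asboolP cg]; apply/asboolP.
  exact: (@cst_continuous K F 0).
move=> x.
by apply: cvgD; [apply: cvgZr; exact: cf|exact: cg].
Qed.

HB.instance Definition _ :=
  GRing.isSubmodClosed.Build F (K -> F^o) cfun_pred cfun_submod_closed.

(* The compactness proof is a parameter of the type because the sup norm below
   is only a norm for compact [K]. *)
Record cspace (cK : compact [set: K]) := Cspace {
  cspace_fun :> K -> F^o;
  cspace_funP : cspace_fun \in cfun_pred }.

Section instances.
Context (cK : compact [set: K]).
Local Notation CK := (cspace cK).

HB.instance Definition _ := [isSub of CK for @cspace_fun cK].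
HB.instance Definition _ := [Choice of CK by <:].
HB.instance Definition _ := [SubChoice_isSubLmodule of CK by <:].

Definition sup_norm (f : CK) : F := supremum 0 (range (fun x => `|f x|)).

Lemma cspace_continuous (f : CK) : continuous (f : K -> F).
Proof. by have /asboolP := cspace_funP f. Qed.

Lemma cspace_bounded (f : CK) : exists M : F, forall x, `|f x| <= M.
Proof.
have cvK : near_covering [set: K] by exact/compact_near_coveringP.
have := cvK F (pinfty_nbhs F) (fun M x => `|f x| <= M) _ => /(_ _)[x _|].
  have := @cspace_continuous f x; move/cvgrPdist_lt => /(_ 1 ltr01) fx.
  exists ([set y | `|f x - f y| < 1], [set M | `|f x| + 1 <= M]).
    split; first exact: fx.
    by apply: nbhs_pinfty_ge; rewrite realD// ?realE ?ler01 ?normr_ge0.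
  move=> -[y M] /= [xy /(le_trans _)->//].
  rewrite -[f y](subKr (f x)) (le_trans (ler_normB _ _))// lerD2l.
  exact: ltW.
move=> M [_ MP]; exists (M + 1) => x; apply: MP => //.
by rewrite ltrDl.
Qed.

Lemma sup_norm_ub (f : CK) x : `|f x| <= sup_norm f.
Proof.
have [M fM] := cspace_bounded f.
have [||| ub _] := @scalar_supremumP R k (range (fun x => `|f x|)).
- by exists `|f x|, x.
- by move=> _ [y _ <-].
- by exists M => _ [y _ <-].
by apply: ub; exists x.
Qed.

Lemma sup_norm_le (f : CK) (M : F) : 0 <= M ->
  (forall x, `|f x| <= M) -> sup_norm f <= M.
Proof.
move=> M0 fM; have [A0|/set0P A0] := eqVneq (range (fun x => `|f x|)) set0.
  by rewrite /sup_norm A0 supremum0.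
have [||| _ lb] := @scalar_supremumP R k (range (fun x => `|f x|)) => //.
- by move=> _ [y _ <-].
- by exists M => _ [y _ <-].
by apply: lb => _ [y _ <-].
Qed.

Lemma sup_norm_ge0 (f : CK) : 0 <= sup_norm f.
Proof.
have [A0|/set0P [_ [x _ _]]] := eqVneq (range (fun x => `|f x|)) set0.
  by rewrite /sup_norm A0 supremum0.
by rewrite (le_trans _ (sup_norm_ub f x)).
Qed.

Lemma sup_normD (f g : CK) : sup_norm (f + g) <= sup_norm f + sup_norm g.
Proof.
apply: sup_norm_le => [|x]; first by rewrite addr_ge0// sup_norm_ge0.
by rewrite (le_trans (ler_normD _ _))// lerD// sup_norm_ub.
Qed.

Lemma sup_normZ (l : F) (f : CK) : sup_norm (l *: f) = `|l| * sup_norm f.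
Proof.
have le c g : sup_norm (c *: g) <= `|c| * sup_norm g.
  apply: sup_norm_le => [|x]; first by rewrite mulr_ge0// sup_norm_ge0.
  by rewrite [`|_|](normrM c (g x)) ler_wpM2l// sup_norm_ub.
have [->|l0] := eqVneq l 0.
  rewrite normr0 mul0r; apply/eqP; rewrite eq_le sup_norm_ge0 andbT.
  by rewrite (le_trans (le _ _))// normr0 mul0r.
apply/eqP; rewrite eq_le le /= -ler_pdivlMl ?normr_gt0//.
by rewrite -{1}[f](scalerK l0) -normfV le.
Qed.

Lemma sup_norm0_eq0 (f : CK) : sup_norm f = 0 -> f = 0.
Proof.
move=> f0; apply: val_inj; apply/funext => x /=.
by apply/eqP; rewrite -normr_le0 -f0 sup_norm_ub.
Qed.

HB.instance Definition _ :=
  Lmodule_isNormed.Build F CK sup_normD sup_normZ sup_norm0_eq0.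

End instances.
End continuous_functions.

Section tensor_power.
Context {F : fieldType} (N : nat) (X : lmodType F).

Definition subst_arg (x : 'I_N -> X) (i : 'I_N) (u : X) : 'I_N -> X :=
  fun j => if j == i then u else x j.

Definition multilinear (V : lmodType F) (A : ('I_N -> X) -> V) :=
  forall (x : 'I_N -> X) (i : 'I_N) (a : F) (u v : X),
    A (subst_arg x i (a *: u + v)) =
    a *: A (subst_arg x i u) + A (subst_arg x i v).

(* The algebraic tensor power is realised, as in Ryan's "Introduction to Tensor
   Products of Banach Spaces", inside the space of functions on the set of
   N-linear forms: [x_1 (x) ... (x) x_N] is evaluation at [(x_1, ..., x_N)], and
   the tensor power is the linear span of these. No continuity is imposed on
   the forms. The universal property is [tensor_universal]: every linear
   relation between elementary tensors is respected by every multilinear map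
   into every vector space. *)
Definition multiform := {A : ('I_N -> X) -> F^o | multilinear A}.

Definition multidual := multiform -> F^o.

HB.instance Definition _ := GRing.Lmodule.on multidual.

Definition tensor (x : 'I_N -> X) : multidual := fun A => sval A x.

Definition tensor_pow (x : X) : multidual := tensor (fun=> x).

Definition symtensor_pred : {pred multidual} := [pred u : multidual |
  `[< exists (n : nat) (lam : 'I_n -> F) (x : 'I_n -> X),
        u = \sum_(i < n) lam i *: tensor_pow (x i) >]].

Lemma symtensor_submod_closed : submod_closed symtensor_pred.
Proof.
split=> [|a u v /asboolP[m [lam [x ->]]] /asboolP[n [mu [y ->]]]].
  by apply/asboolP; exists 0, (fun=> 0), (fun=> 0); rewrite big_ord0.
apply/asboolP; exists (m + n)%N.
exists (fun i => match fintype.split i with inl j => a * lam j | inr j => mu j end).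
exists (fun i => match fintype.split i with inl j => x j | inr j => y j end).
rewrite big_split_ord scaler_sumr /=; congr (_ + _); apply: eq_bigr => i _.
  by rewrite (unsplitK (inl i : 'I_m + 'I_n)) scalerA.
by rewrite (unsplitK (inr i : 'I_m + 'I_n)).
Qed.

HB.instance Definition _ :=
  GRing.isSubmodClosed.Build F multidual symtensor_pred symtensor_submod_closed.

Record symtensor := Symtensor {
  symtensor_val :> multidual;
  symtensor_valP : symtensor_val \in symtensor_pred }.

HB.instance Definition _ := [isSub of symtensor for symtensor_val].
HB.instance Definition _ := [Choice of symtensor by <:].
HB.instance Definition _ := [SubChoice_isSubLmodule of symtensor by <:].

End tensor_power.

Section tensor_universal.
Context {F : fieldType}.

Lemma linear_form_separation (V : lmodType F) (v : V) : v != 0 ->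
  exists2 f : V -> F^o, linear f & f v != 0.
Proof.
move=> v0.
pose lin (W : set V) := forall a x y, W x -> W y -> W (a *: x + y).
have [|W [[linW Wv] maxW]] := @Zorn_bigcup V [set W | lin W /\ ~ W v].
  move=> C CP tot; split; last by move=> [W /CP[_ Wv] /Wv].
  move=> a x y [W1 C1 W1x] [W2 C2 W2y].
  have [W12|W21] := tot _ _ C1 C2.
    by exists W2 => //; apply: (CP _ C2).1 => //; exact: W12.
  by exists W1 => //; apply: (CP _ C1).1 => //; exact: W21.
pose W0 := [set x | x = 0 \/ W x].
have linW0 : lin W0.
  move=> a x y [->|Wx] [->|Wy]; rewrite /W0 /= ?scaler0 ?add0r ?addr0.
  - by left.
  - by right.
  - right; have := linW a x _ Wx (linW (-1) x x Wx Wx).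
    by rewrite scaleN1r addNr addr0.
  - by right; exact: linW.
have W0v : ~ W0 v by move=> [/eqP|//]; rewrite (negbTE v0).
have W00 : W0 0 by left.
have W0Z a x : W0 x -> W0 (a *: x).
  by move=> Wx; have := linW0 a x 0 Wx W00; rewrite addr0.
have W0D x y : W0 x -> W0 y -> W0 (x + y).
  by move=> Wx; have := linW0 1 x y Wx; rewrite scale1r.
have dec y : exists c, W0 (y - c *: v).
  have [Wy|Wy] := pselect (W0 y); first by exists 0; rewrite scale0r subr0.
  pose B := [set z | exists c, W0 (z - c *: y)].
  have linB : lin B.
    move=> a s t [c Ws] [d Wt]; exists (a * c + d).
    by rewrite scalerDl -scalerA opprD addrACA -scalerBr; exact: linW0.
  have WB : W `<` B.
    split; last first.
      move=> BW; apply: Wy; right; apply: BW.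
      by exists 1; rewrite scale1r subrr.
    by move=> z Wz; exists 0; rewrite scale0r subr0; right.
  have [[c Wvc]|Bv] := pselect (B v); last by case: (maxW _ WB).
  have c0 : c != 0.
    by apply/eqP => c0; move: Wvc; rewrite c0 scale0r subr0.
  exists c^-1; have := W0Z (- c^-1) _ Wvc.
  by rewrite scalerBr !scaleNr opprK scalerA mulVf// scale1r addrC.
have uniq_dec y c d : W0 (y - c *: v) -> W0 (y - d *: v) -> c = d.
  move=> Wc Wd; apply/eqP; rewrite -subr_eq0; apply/negP => /negP cd0.
  apply: W0v; have := W0Z (c - d)^-1 _ (W0D _ _ Wd (W0Z (-1) _ Wc)).
  have -> : y - d *: v + -1 *: (y - c *: v) = (c - d) *: v.
    by rewrite scaleN1r opprB [LHS]addrC addrA subrK -scalerBl.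
  by rewrite scalerA mulVf// scale1r.
pose f y : F^o := sval (cid (dec y)).
have fP y : W0 (y - f y *: v) by rewrite /f; case: cid.
exists f.
  move=> a x y; apply: (uniq_dec (a *: x + y)) => //.
  rewrite scalerDl -[(a *: f x) *: v]scalerA opprD addrACA -scalerBr.
  exact: linW0.
suff -> : f v = 1 by exact: oner_neq0.
by apply: (uniq_dec v) => //; rewrite scale1r subrr.
Qed.

Lemma tensor_universal (N : nat) (X V : lmodType F) (B : ('I_N -> X) -> V)
    (n : nat) (lam : 'I_n -> F) (x : 'I_n -> 'I_N -> X) : multilinear B ->
  \sum_(i < n) lam i *: tensor (x i) = 0 -> \sum_(i < n) lam i *: B (x i) = 0.
Proof.
move=> mB sum0; apply/eqP; apply: contrapT => /negP.
move=> /linear_form_separation[f linf].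
have mfB : multilinear (V := F^o) (f \o B).
  by move=> y i a u w /=; rewrite mB linf.
have [f0 fD fZ] : [/\ f 0 = 0, {morph f : u w / u + w} &
    forall a u, f (a *: u) = a *: f u].
  have fD : {morph f : u w / u + w}.
    by move=> u w; have := linf 1 u w; rewrite !scale1r.
  have f0 : f 0 = 0 by apply: (addrI (f 0)); rewrite -fD !addr0.
  by split => // a u; have := linf a u 0; rewrite !addr0 f0 addr0.
rewrite (big_morph f fD f0); apply/negP; rewrite negbK.
move: sum0 => /(congr1 (fun u : multidual N X => u (exist _ _ mfB))).
rewrite fct_sumE => e0; apply/eqP; rewrite -[RHS]e0; apply: eq_bigr => i _.
by rewrite fZ.
Qed.

End tensor_universal.

Section projective_symmetric_norm.
Context {F : numFieldType} (N : nat) (X : normedModType F).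

Definition proj_sym_norm (u : symtensor N X) : F :=
  infimum 0 [set r | exists (n : nat) (lam : 'I_n -> F) (x : 'I_n -> X),
    [/\ (0 < n)%N,
        symtensor_val u = \sum_(i < n) lam i *: tensor_pow (x i) &
        r = \sum_(i < n) `|lam i| * `|x i| ^+ N]].

End projective_symmetric_norm.

(* [Z], with [iota], is a completion of [E] for [nrm]; it is determined by this
   up to a linear isometry, under which [weak_DD2P] is invariant. *)
Definition is_completion (F : numFieldType) (E : lmodType F) (nrm : E -> F)
    (Z : completeNormedModType F) (iota : {linear E -> Z}) :=
  (forall u, `|iota u| = nrm u) /\ dense (range iota).

Section weak_DD2P.
Context {F : numFieldType} (Z : normedModType F).

Definition topdual := {f : {scalar Z} | continuous (f : Z -> F)}.

Definition weak_space := sup_topology (fun f : topdual =>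
  Topological.class (initial_topology (sval f : Z -> F))).

Definition unit_ball : set Z := [set z | `|z| <= 1].

Definition rel_weak_open (W : set Z) :=
  exists2 U : set weak_space, open U & W = U `&` unit_ball.

Definition weak_DD2P := forall W : set Z, rel_weak_open W -> W !=set0 ->
  exists2 z, W z & forall V : set Z, rel_weak_open V -> V z ->
    supremum 0 [set `|z - y| | y in V] = 2.

End weak_DD2P.

(* Main.v *)
Require Import Defs.
From mathcomp Require Import all_boot all_order all_algebra finmap complex.
From mathcomp Require Import all_classical all_reals all_analysis.
From mathcomp Require Import ring.

Set Implicit Arguments.
Unset Strict Implicit.
Unset Printing Implicit Defensive.

Import Order.TTheory GRing.Theory Num.Theory.
Import numFieldNormedType.Exports.

Local Open Scope classical_set_scope.
Local Open Scope ring_scope.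

(** Write x^N for the N-th tensor power of x. A nonempty relatively weakly open
set W of the unit ball contains the image of some u = sum_i lam_i x_i^N with
|x_i| <= 1 and sum_i |lam_i| = 1 (the missing mass is carried by x_i = 0).

The engine is that x |-> x^N is insensitive, in the weak topology, to
modifications of x on small sets. If U_0, ..., U_(M-1) are disjoint and x'_n is
a function of norm at most 1 that equals x off U_n, then all the sums
sum_(n in B) (x'_n^N - x^N) have norm at most a constant C depending only on N
([bounded_sum_increments]). Indeed, glue the modifications indexed by a random
set S containing each n independently with probability t. The expectation of
the N-th power of the glued function is a polynomial in t of degree at most N
with values in the unit ball, and sum_n (x'_n^N - x^N) is its coefficient of
degree 1, hence a combination of its values at N + 1 points of [0, 1]
([sum_sympow_increments]). Subset sums that are bounded independently of M force
sum_n |f d_n|^2 to be bounded for every functional f, by a choice of signs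
([exists_signs]); so for M large some increment d_n is small against any
prescribed finite set of functionals ([weakly_small_of_bounded_sums]). The
outcome is [local_weak_perturbation]: given infinitely many points, all the x_i
can be modified near one of them without leaving a weakly open set.

It is used twice. Since K' is infinite, the x_i can be modified near some
cluster point t2, at t2 and at a nearby t1, so that x_i(t1) = 1 and
x_i(t2) = c_i, where |c_i| = 1 and lam_i c_i = |lam_i|, with z = sum_i lam_i x_i^N
still in W. This z is the required point. Given a weakly open V containing z
and e > 0, there are infinitely many s <> t1 close to t2 with |x_i(s) - c_i| < e;
modify again near one of them, so that y_i(t1) = 1, y_i(s) = - c_i and
y = sum_i lam_i y_i^N is in V. The N-linear form
(v_1, ..., v_N) |-> v_1(s) v_2(t1) ... v_N(t1) has norm at most 1 and maps z - y to
sum_i lam_i (x_i(s) + c_i), which is within e of 2 sum_i |lam_i| = 2. Two points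
t1 and s are used, rather than s alone, because for real scalars and even N the
numbers x_i(s)^N cannot have the signs of the lam_i; the factors at t1, all
equal to 1 here, replace x_i(s)^N by x_i(s), whose sign is free. *)

(** * Finite differences of homogeneous maps *)

Section random_subset.
Context {F : comNzRingType} {I : finType}.

(** The probability of [S] when each element is drawn independently with
    probability [t]. *)
Definition subset_weight (t : F) (S : {set I}) : F :=
  \prod_i (if i \in S then t else 1 - t).

(** The drawn set contains [T] with probability [t ^+ #|T|]: expand the product
    over [i] of [t + (1 - t) * (i \notin T)]. *)
Lemma subset_weight_sub (t : F) (T : {set I}) :
  \sum_(S : {set I}) subset_weight t S * (T \subset S)%:R = t ^+ #|T|.
Proof.
transitivity (\prod_(i : I) (t + (1 - t) * (i \notin T)%:R)).
  rewrite bigA_distr; apply: eq_bigr => S _; rewrite /subset_weight.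
  have [TS|/subsetPn[i iT iS]] := boolP (T \subset S).
    rewrite mulr1; apply: eq_bigr => i _; case: ifPn => // iS.
    by rewrite (contra (fintype.subsetP TS i) iS) mulr1.
  rewrite mulr0; apply/esym; rewrite (bigD1 i)//= (negbTE iS) iT.
  by rewrite mulr0 mul0r.
rewrite -[RHS]prodr_const [RHS]big_mkcond/=; apply: eq_bigr => i _.
by case: (i \in T); rewrite /= ?mulr0 ?addr0 ?mulr1 1?addrC ?subrK.
Qed.

Lemma sum_subset_weight (t : F) : \sum_(S : {set I}) subset_weight t S = 1.
Proof.
have := subset_weight_sub t finset.set0; rewrite cards0 expr0 => <-.
by apply: eq_bigr => S _; rewrite finset.sub0set mulr1.
Qed.

End random_subset.

Lemma subset_weight_ge0 {F : numDomainType} {I : finType} (t : F) (S : {set I}) :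
  0 <= t <= 1 -> 0 <= subset_weight t S.
Proof.
by move=> /andP[t0 t1]; apply: prodr_ge0 => i _; case: ifP; rewrite ?subr_ge0.
Qed.

(** Extracting the coefficient of degree 1 of a polynomial of degree at most
    [N] from its values at the [N.+1] points [j / N.+1] of [[0, 1]]: the weights
    [c] solve a Vandermonde system. *)
Lemma linear_coef_interpolation (F : numFieldType) (N : nat) : exists c t : 'I_N.+1 -> F,
  (forall j, 0 <= t j <= 1) /\
  forall k, (k <= N)%N -> \sum_j c j * t j ^+ k = (k == 1)%:R.
Proof.
pose t : 'rV[F]_N.+1 := \row_j (j%:R / N.+1%:R).
have N0 : 0 < N.+1%:R :> F by rewrite ltr0n.
have Vu : Vandermonde N.+1 t \in unitmx.
  rewrite unitmxE unitfE det_Vandermonde; apply/prodf_neq0 => i _.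
  apply/prodf_neq0 => j ij; rewrite !mxE -mulrBl mulf_neq0 ?invr_neq0 ?(gt_eqF N0)//.
  by rewrite subr_eq0 eqr_nat gtn_eqF.
pose e : 'cV[F]_N.+1 := \col_i ((i : nat) == 1)%:R.
pose c := invmx (Vandermonde N.+1 t) *m e.
exists (fun j => c j 0), (fun j => t 0 j); split=> [j|k kN].
  rewrite mxE divr_ge0 ?ler0n//= ler_pdivrMr// mul1r ler_nat.
  exact/ltnW/ltn_ord.
have : Vandermonde N.+1 t *m c = e by rewrite mulKVmx.
move/matrixP => /(_ (Ordinal (kN : (k < N.+1)%N)) 0); rewrite mxE [RHS]mxE => <-.
by apply: eq_bigr => j _; rewrite [Vandermonde _ _ _ _]mxE mulrC.
Qed.

Section multilinear_theory.
Context {F : fieldType} {N : nat} {X V : lmodType F} (A : ('I_N -> X) -> V).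
Hypothesis mA : multilinear A.

(** Interpolates between [v] and the constant family [y], one argument at a
    time, so that proofs can go by induction on the number of arguments
    already equal to [y]. *)
Definition fill_below (k : nat) (y : X) (v : 'I_N -> X) : 'I_N -> X :=
  fun i => if (i < k)%N then y else v i.

Lemma fill_below0 y v : fill_below 0 y v = v.
Proof. by []. Qed.

Lemma fill_below_full y v : fill_below N y v = fun=> y.
Proof. by apply/funext => i; rewrite /fill_below ltn_ord. Qed.

Lemma fill_belowS k (kN : (k < N)%N) y v :
  fill_below k.+1 y v = fill_below k y (subst_arg v (Ordinal kN) y).
Proof.
apply/funext => i; rewrite /fill_below /subst_arg ltnS leq_eqVlt -val_eqE /=.
by case: ltngtP.
Qed.

Lemma fill_below_subst k (kN : (k < N)%N) y v u :
  fill_below k y (subst_arg v (Ordinal kN) u) =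
  subst_arg (fill_below k y v) (Ordinal kN) u.
Proof.
apply/funext => i; rewrite /fill_below /subst_arg -val_eqE /=.
by case: ltngtP.
Qed.

Lemma multilinearD x i u v :
  A (subst_arg x i (u + v)) = A (subst_arg x i u) + A (subst_arg x i v).
Proof. by have := mA x i 1 u v; rewrite !scale1r. Qed.

Lemma multilinear0 x i : A (subst_arg x i 0) = 0.
Proof. by apply: (addrI (A (subst_arg x i 0))); rewrite -multilinearD !addr0. Qed.

Lemma multilinearZ x i a u : A (subst_arg x i (a *: u)) = a *: A (subst_arg x i u).
Proof. by have := mA x i a u 0; rewrite multilinear0 !addr0. Qed.

Lemma multilinear_sum (J : Type) (r : seq J) (P : pred J) x i (u : J -> X) :
  A (subst_arg x i (\sum_(j <- r | P j) u j)) =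
  \sum_(j <- r | P j) A (subst_arg x i (u j)).
Proof.
by apply: (big_morph (fun u => A (subst_arg x i u))); [exact: multilinearD|exact: multilinear0].
Qed.

Lemma multilinear_homogeneous a x : A (fun=> a *: x) = a ^+ N *: A (fun=> x).
Proof.
suff H k : (k <= N)%N ->
    A (fill_below k (a *: x) (fun=> x)) = a ^+ k *: A (fun=> x).
  by rewrite -H// fill_below_full.
elim: k => [_|k IH kN]; first by rewrite fill_below0 scale1r.
rewrite fill_belowS fill_below_subst multilinearZ -fill_below_subst exprS.
rewrite -scalerA -IH 1?ltnW//; congr (_ *: A (fill_below _ _ _)).
by apply/funext => i; rewrite /subst_arg; case: eqP.
Qed.

End multilinear_theory.

Section linear_part.
Context {F : fieldType} {I : finType} {p : nat} (c t : 'I_p -> F).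

(** The difference between the sum of the increments of [G] at singletons and
    the interpolated coefficient of degree 1 of the expectation of [G] over a
    random set. *)
Definition linear_defect (G : {set I} -> F) : F :=
  \sum_n (G (finset.set1 n) - G finset.set0) -
  \sum_j c j * \sum_S subset_weight (t j) S * G S.

Lemma linear_defect_sum (J : Type) (r : seq J) (a : J -> F)
    (G : J -> {set I} -> F) :
  linear_defect (fun S => \sum_(l <- r) a l * G l S) =
  \sum_(l <- r) a l * linear_defect (G l).
Proof.
rewrite /linear_defect; under [RHS]eq_bigr do rewrite mulrBr.
rewrite [RHS]sumrB; congr (_ - _).
  under eq_bigr do rewrite -sumrB.
  rewrite exchange_big; apply: eq_bigr => l _ /=; rewrite mulr_sumr.
  by apply: eq_bigr => n _; rewrite mulrBr.
transitivity (\sum_j \sum_(l <- r) a l * (c j * \sum_S subset_weight (t j) S * G l S)).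
  apply: eq_bigr => j _; under [RHS]eq_bigr do rewrite mulrCA.
  rewrite -mulr_sumr; congr (_ * _); under [RHS]eq_bigr do rewrite mulr_sumr.
  rewrite exchange_big; apply: eq_bigr => S _ /=; rewrite mulr_sumr.
  by apply: eq_bigr => l _; rewrite mulrCA.
by rewrite exchange_big; apply: eq_bigr => l _ /=; rewrite mulr_sumr.
Qed.

Variable N : nat.
Hypothesis ctN : forall k, (k <= N)%N -> \sum_j c j * t j ^+ k = (k == 1)%:R.

(** The expectation of [T \subset S] is [t ^+ #|T|], of which the interpolation
    detects whether [#|T| = 1]; so does the sum of increments. *)
Lemma linear_defect_sub (T : {set I}) : (#|T| <= N)%N ->
  linear_defect (fun S => (T \subset S)%:R) = 0.
Proof.
move=> TN; rewrite /linear_defect.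
under [X in _ - X]eq_bigr do rewrite subset_weight_sub.
rewrite ctN//; apply/eqP; rewrite subr_eq0; apply/eqP.
have [->|/finset.set0Pn[a aT]] := eqVneq T finset.set0.
  rewrite cards0 /= big1// => n _; rewrite !finset.sub0set subrr//.
have T0 : T != finset.set0 by apply/finset.set0Pn; exists a.
transitivity (\sum_n (T == finset.set1 n)%:R : F).
  apply: eq_bigr => n _.
  by rewrite finset.subset1 finset.subset0 (negbTE T0) orbF subr0.
have [/cards1P[b Tb]|T1] := boolP (#|T| == 1)%N.
  rewrite Tb (bigD1 b)//= eqxx big1 ?addr0// => n nb.
  by rewrite (inj_eq finset.set1_inj) eq_sym (negbTE nb).
rewrite big1// => n _; case: eqP => // Tn; by rewrite Tn cards1 in T1.
Qed.

(** Expanding by multilinearity, [A] at the sum over [S] is a combination of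
    indicators [T \subset S] with [#|T| <= N]. The induction consumes one
    argument at a time: its summand [h n] contributes the factor [n \in S], which
    enlarges [T] by [n]. *)
Lemma linear_defect_multilinear {X : lmodType F} (A : ('I_N -> X) -> F^o)
    (x : X) (h : I -> X) : multilinear A ->
  linear_defect (fun S => A (fun=> x + \sum_(n in S) h n)) = 0.
Proof.
move=> mA; pose y (S : {set I}) := x + \sum_(n in S) h n.
suff H k (T : {set I}) v : (k <= N)%N -> (#|T| + k <= N)%N ->
    linear_defect (fun S => (T \subset S)%:R * A (fill_below k (y S) v)) = 0.
  have := H N finset.set0 (fun=> 0) (leqnn N); rewrite cards0 => /(_ (leqnn N)).
  congr (linear_defect _ = 0); apply/funext => S.
  by rewrite finset.sub0set mul1r fill_below_full.
elim: k T v => [|k IH] T v kN TkN.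
  have := linear_defect_sum [:: tt] (fun=> A v) (fun _ S => (T \subset S)%:R).
  rewrite !big_seq1 linear_defect_sub ?mulr0; last by rewrite addn0 in TkN.
  move=> <-; congr linear_defect; apply/funext => S.
  by rewrite big_seq1 fill_below0 mulrC.
have kN' := ltnW kN.
pose v' o := subst_arg v (Ordinal kN) (if o is Some n then h n else x).
pose T' o := if o is Some n then finset.setU (finset.set1 n) T else T.
have := linear_defect_sum (None :: map Some (index_enum I)) (fun=> 1)
  (fun o S => (T' o \subset S)%:R * A (fill_below k (y S) (v' o))).
rewrite [X in _ = X -> _]big1 => [<-|o _].
  congr linear_defect; apply/funext => S; rewrite big_cons big_map /= !mul1r.
  rewrite fill_belowS !fill_below_subst {3}/y (multilinearD mA) (multilinear_sum mA).
  rewrite mulrDr; congr (_ + _).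
  rewrite mulr_sumr [LHS]big_mkcond; apply: eq_bigr => n _ /=.
  rewrite mul1r finset.subUset finset.sub1set fill_below_subst.
  by case: (n \in S); rewrite // mul0r.
rewrite mul1r; apply: IH => //; case: o => [n|] /=.
  by rewrite (leq_trans _ TkN)// addnS -addSn leq_add2r cardsU1; case: (n \in T).
by rewrite (leq_trans _ TkN)// leq_add2l.
Qed.

End linear_part.

(** * Weak topology *)

Section scalars.
Context {R : realType} {k : scalar_kind}.
Local Notation F := (scalar_field R k).

Lemma scalar_parallelogram (a b : F) :
  `|a + b| ^+ 2 + `|a - b| ^+ 2 = 2 * (`|a| ^+ 2 + `|b| ^+ 2).
Proof.
have E (T : comNzRingType) (u v u' v' : T) :
    (u + v) * (u' + v') + (u - v) * (u' - v') = 2 * (u * u' + v * v') by ring.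
case: k a b => /= a b.
  by rewrite !real_normK ?num_real// !expr2 E.
by rewrite !normCK rmorphD rmorphB E.
Qed.

Lemma scalar_archimedean (x : F) : exists M : nat, `|x| < M%:R.
Proof.
case: k x => /= x; first by exists (Num.bound `|x|); exact: archi_boundP.
exists (Num.bound (complex.Re `|x|)).
have := normr_ge0 x; move: `|x| => [u v]; rewrite lecE /= => /andP[/eqP -> u0].
by rewrite -(rmorph_nat (real_complex R)) ltcR archi_boundP.
Qed.

(** By the parallelogram law, one of [s + a] and [s - a] has a square of modulus
    at least [`|s| ^+ 2 + `|a| ^+ 2]; choose the signs one after the other. *)
Lemma exists_signs (I : finType) (a : I -> F) : exists B : {set I},
  \sum_n `|a n| ^+ 2 <= `|\sum_(n in B) a n - \sum_(n in ~: B) a n| ^+ 2.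
Proof.
suff H (r : seq I) : uniq r -> exists B : {set I}, \sum_(n <- r) `|a n| ^+ 2 <=
    `|\sum_(n <- r) (if n \in B then a n else - a n)| ^+ 2.
  have [B HB] := H _ (index_enum_uniq I); exists B.
  rewrite (le_trans HB)// big_if /= sumrN.
  by under [X in _ <= `|_ - X| ^+ 2]eq_bigl do rewrite finset.in_setC.
elim: r => [_|m r IH /= /andP[mr /IH[B HB]]].
  by exists finset.set0; rewrite !big_nil normr0 expr0n.
set s := (X in _ <= `|X| ^+ 2) in HB.
have sE (B' : {set I}) : (forall n, n \in r -> (n \in B') = (n \in B)) ->
    s = \sum_(n <- r) (if n \in B' then a n else - a n).
  by move=> BB; rewrite /s big_seq [RHS]big_seq; apply: eq_bigr => n /BB ->.
have nr n : n \in r -> n != m by apply: contraTN => /eqP ->.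
(* If [s + a m] is too short then [a m - s] is long enough, and [m] gets the
   opposite sign. *)
pose x := `|a m| ^+ 2 + `|s| ^+ 2.
have [up|up] := boolP (x <= `|a m + s| ^+ 2).
  exists (finset.setU (finset.set1 m) B).
  rewrite !big_cons finset.setU11 -sE => [|n /nr nm]; last first.
    by rewrite finset.in_setU1 (negbTE nm).
  by rewrite (le_trans _ up)// lerD2l.
exists (finset.setD B (finset.set1 m)).
rewrite !big_cons finset.setD11 -sE => [|n /nr nm]; last first.
  by rewrite finset.in_setD1 nm.
suff lo : x <= `|a m - s| ^+ 2.
  by rewrite [- _ + _]addrC distrC (le_trans _ lo)// lerD2l.
have rx : x \is Num.real by rewrite realE addr_ge0// exprn_ge0.
have rn (z : F) : `|z| ^+ 2 \is Num.real by rewrite realE exprn_ge0.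
rewrite real_leNgt//; apply/negP => lo.
move: up; rewrite -real_ltNge// => up.
have := ltrD up lo; rewrite scalar_parallelogram -/x mulrDl mul1r.
by rewrite ltxx.
Qed.

End scalars.

Section weak_topology.
Context {R : realType} {k : scalar_kind}.
Local Notation F := (scalar_field R k).
Context {Z : normedModType F}.

Lemma topdual_bounded (f : topdual Z) :
  exists2 D : F, 0 <= D & forall w, `|sval f w| <= D * `|w|.
Proof.
have /continuous_linear_bounded bf : {for 0, continuous (sval f : Z -> F^o)}.
  exact: (svalP f).
have [M M0 MP] := pinfty_ex_gt0 ((linear_boundedP _).1 (bf 0)).
by exists M => //; exact: ltW.
Qed.

(** The sets determined by finitely many functionals generate a filter that
    converges to [z] for each of the topologies whose supremum is the weak one. *)
Lemma weak_open_basis (U : set (weak_space Z)) (z : Z) : open U -> U z ->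
  exists (J : finType) (f : J -> topdual Z) (e : J -> F),
    (forall j, 0 < e j) /\
    forall w : Z, (forall j, `|sval (f j) z - sval (f j) w| < e j) -> U w.
Proof.
move=> oU Uz.
pose G : set_system Z := [set B | exists (J : finType) (f : J -> topdual Z)
  (e : J -> F), (forall j, 0 < e j) /\
  forall w : Z, (forall j, `|sval (f j) z - sval (f j) w| < e j) -> B w].
have GF : Filter G.
  split.
  - exists void, (fun v : void => match v with end), (fun=> 1); split=> //.
  - move=> A B [J [f [e [e0 fA]]]] [J' [f' [e' [e0' fB]]]].
    exists (J + J')%type, (fun j => match j with inl j => f j | inr j => f' j end).
    exists (fun j => match j with inl j => e j | inr j => e' j end).
    split=> [[]//|w H]; split.
      by apply: fA => j; exact: (H (inl j)).
    by apply: fB => j; exact: (H (inr j)).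
  - move=> A B AB [J [f [e [e0 fA]]]]; exists J, f, e; split=> // w H.
    exact/AB/fA.
suff : G --> (z : weak_space Z) by apply; exact: open_nbhs_nbhs.
apply/cvg_sup => f A /= [_ [[B oB <-] /= Bz] BA].
have /nbhs_ballP[e /= e0 eB] : nbhs (sval f z : F) B by apply: open_nbhs_nbhs.
exists unit, (fun=> f), (fun=> e); split=> // w /(_ tt) H.
by apply: BA; exact: eB.
Qed.

(** For each [j], some choice of signs gives
    [\sum_n `|f j (d n)| ^+ 2 <= `|f j (\sum_n +/- d n)| ^+ 2], and the right-hand
    side is bounded since a signed sum is the difference of two subset sums. If
    every [d n] failed for some [j], the total over [n] and [j], rescaled by [e j],
    would be at least [M]. *)
Lemma weakly_small_of_bounded_sums (J : finType) (f : J -> topdual Z)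
    (e : J -> F) (C : F) : (forall j, 0 < e j) ->
  exists M : nat, forall d : 'I_M -> Z,
    (forall B : {set 'I_M}, `|\sum_(n in B) d n| <= C) ->
    exists n, forall j, `|sval (f j) (d n)| < e j.
Proof.
move=> e0; have /choice[D DP] : forall j, exists D : F, 0 <= D /\
    forall w, `|sval (f j) w| <= D * `|w|.
  by move=> j; have [D ? ?] := topdual_bounded (f j); exists D.
pose s := \sum_j (D j * (C + C) / e j) ^+ 2.
have [M sM] := scalar_archimedean s; exists M => d dC.
apply: contrapT => /forallNP H.
have {}H n : exists j, e j <= `|sval (f j) (d n)|.
  have /existsNP[j /negP Hj] := H n; exists j.
  by rewrite real_leNgt ?(gtr0_real (e0 j)) ?normr_real.
suff : M%:R <= s.
  move=> Ms; have s0 : 0 <= s by rewrite (le_trans _ Ms).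
  by rewrite (ger0_norm s0) in sM; have := le_lt_trans Ms sM; rewrite ltxx.
pose a j n := sval (f j) (d n).
apply: (@le_trans _ _ (\sum_(n < M) \sum_j (`|a j n| / e j) ^+ 2)).
  rewrite -[M in M%:R]card_ord -sumr_const ler_sum// => n _.
  have [j Hj] := H n; rewrite (bigD1 j)//= -[leLHS]addr0 lerD//; last first.
    by rewrite sumr_ge0// => i _; rewrite exprn_ge0// divr_ge0// ltW.
  by rewrite exprn_ege1// ler_pdivlMr// mul1r.
rewrite exchange_big ler_sum//= => j _.
under eq_bigr do rewrite expr_div_n.
rewrite -mulr_suml [leRHS]expr_div_n ler_wpM2r ?invr_ge0 ?exprn_ge0 ?(ltW (e0 j))//.
have [B /le_trans] := exists_signs (a j); apply.
have [D0 Df] := DP j.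
rewrite lerXn2r ?nnegrE//.
  by apply: mulr_ge0 => //; have := dC finset.set0; rewrite big_set0 normr0 => C0; rewrite addr_ge0.
rewrite /a -!linear_sum -linearB (le_trans (Df _))// ler_wpM2l//.
by rewrite (le_trans (ler_normB _ _))// lerD.
Qed.

End weak_topology.

(** * The projective symmetric norm *)

(** The infimum is obtained as the supremum of the nonnegative lower bounds;
    the other lower bounds are real, hence negative. *)
Lemma scalar_infimumP {R : realType} {k : scalar_kind}
    (A : set (scalar_field R k)) : A !=set0 ->
  (forall a, A a -> 0 <= a) -> infimums A (infimum 0 A).
Proof.
move=> A0 Age0; rewrite /infimum; case: ifPn => [/eqP AE|_].
  by move: A0; rewrite AE => -[].
suff [s sA] : infimums A !=set0 by case: xgetP => [y _ //|/(_ s)].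
pose L := [set b | 0 <= b /\ lbound A b].
have L0 : L 0 by split=> // a /Age0.
have uL a : A a -> ubound L a by move=> Aa b [_ /(_ a Aa)].
have [|||s [uLs lLs]] := @scalar_supremums_neq0 R k L.
- by exists 0.
- by move=> b [].
- by case: A0 => a /uL; exists a.
exists s; split=> [a /uL /lLs //|b bA].
have [a Aa] := A0.
have rb : b \is Num.real by rewrite (ler_real (bA a Aa)) ger0_real// Age0.
have /orP[b0|b0] := real_leVge (real0 _) rb; first by apply: uLs.
by rewrite (le_trans b0)// uLs.
Qed.

Section projective_symmetric_norm_theory.
Context {R : realType} {k : scalar_kind}.
Local Notation F := (scalar_field R k).
Context {N : nat} {X : normedModType F}.

Lemma proj_sym_normP (u : symtensor N X) :
  infimums [set r | exists (n : nat) (lam : 'I_n -> F) (x : 'I_n -> X),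
    [/\ (0 < n)%N,
        symtensor_val u = \sum_(i < n) lam i *: tensor_pow (x i) &
        r = \sum_(i < n) `|lam i| * `|x i| ^+ N]] (proj_sym_norm u).
Proof.
apply: scalar_infimumP.
  have /asboolP[n [lam [x uE]]] := symtensor_valP u.
  pose lam' i := if unlift ord0 i is Some j then lam j else 0.
  pose x' i := if unlift ord0 i is Some j then x j else 0.
  exists (\sum_(i < n.+1) `|lam' i| * `|x' i| ^+ N), n.+1, lam', x'.
  split=> //; rewrite big_ord_recl /lam' unlift_none scale0r add0r uE.
  by apply: eq_bigr => i _; rewrite /x' liftK.
move=> _ [n [lam [x [_ _ ->]]]]; apply: sumr_ge0 => i _.
by rewrite mulr_ge0// exprn_ge0.
Qed.

Lemma proj_sym_norm_lt (u : symtensor N X) (b : F) : proj_sym_norm u < b ->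
  exists (n : nat) (lam : 'I_n -> F) (x : 'I_n -> X),
    symtensor_val u = \sum_(i < n) lam i *: tensor_pow (x i) /\
    \sum_(i < n) `|lam i| * `|x i| ^+ N < b.
Proof.
move=> ub; apply: contrapT => H; have [lb glb] := proj_sym_normP u.
have nu : 0 <= proj_sym_norm u.
  apply: glb => _ [n [lam [x [_ _ ->]]]]; apply: sumr_ge0 => i _.
  by rewrite mulr_ge0// exprn_ge0.
suff : b <= proj_sym_norm u by move=> /(lt_le_trans ub); rewrite ltxx.
apply: glb => _ [n [lam [x [_ uE ->]]]].
have r0 : 0 <= \sum_(i < n) `|lam i| * `|x i| ^+ N.
  by apply: sumr_ge0 => i _; rewrite mulr_ge0// exprn_ge0.
rewrite real_leNgt ?ger0_real ?(le_trans nu (ltW ub))//; apply/negP => rb.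
by apply: H; exists n, lam, x.
Qed.

Lemma tensor_pow_symtensor (x : X) : tensor_pow x \in @symtensor_pred F N X.
Proof.
by apply/asboolP; exists 1, (fun=> 1), (fun=> x); rewrite big_ord1 scale1r.
Qed.

Definition sympow (x : X) : symtensor N X := Symtensor (tensor_pow_symtensor x).

Lemma proj_sym_norm_sympow (x : X) : proj_sym_norm (sympow x) <= `|x| ^+ N.
Proof.
apply: (proj_sym_normP _).1; exists 1, (fun=> 1), (fun=> x).
by split; rewrite // big_ord1 ?scale1r// normr1 mul1r.
Qed.

Lemma sympowZ (a : F) (x : X) : sympow (a *: x) = a ^+ N *: sympow x.
Proof.
by apply: val_inj; apply/funext => A; exact: (multilinear_homogeneous (svalP A)).
Qed.

Lemma symtensor_valE (n : nat) (lam : 'I_n -> F) (x : 'I_n -> X)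
    (u : symtensor N X) :
  symtensor_val u = \sum_(i < n) lam i *: tensor_pow (x i) ->
  u = \sum_(i < n) lam i *: sympow (x i).
Proof.
move=> uE; apply: val_inj; rewrite [LHS]uE linear_sum; apply: eq_bigr => i _.
by rewrite linearZ.
Qed.

(** An [N]-homogeneous polynomial of norm at most 1 is dominated by the
    projective norm; this is the easy half of the duality. *)
Lemma proj_sym_norm_ge (A : multiform N X) (u : symtensor N X) :
  (forall x, `|sval A (fun=> x)| <= `|x| ^+ N) ->
  `|symtensor_val u A| <= proj_sym_norm u.
Proof.
move=> Ax; apply: (proj_sym_normP u).2 => _ [n [lam [x [_ -> ->]]]].
rewrite fct_sumE (le_trans (ler_norm_sum _ _ _))// ler_sum// => i _.
by rewrite [leLHS](normrM (lam i) (sval A (fun=> x i))) ler_wpM2l.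
Qed.

Lemma sum_sympow_increments (p : nat) (c t : 'I_p -> F) (I : finType) (x : X)
    (h : I -> X) :
  (forall m, (m <= N)%N -> \sum_j c j * t j ^+ m = (m == 1)%:R) ->
  \sum_n (sympow (x + h n) - sympow x) =
  \sum_j c j *: \sum_(S : {set I}) subset_weight (t j) S *:
    sympow (x + \sum_(n in S) h n).
Proof.
move=> ctN; apply: val_inj; apply/funext => A.
rewrite !linear_sum !fct_sumE; apply/eqP; rewrite -subr_eq0; apply/eqP.
rewrite -[RHS](linear_defect_multilinear ctN x h (svalP A)) /linear_defect.
congr (_ - _); apply: eq_bigr => i _.
  by rewrite linearB /= finset.big_set1 finset.big_set0 addr0.
rewrite linearZ linear_sum /= [LHS]/(c i * _) fct_sumE; congr (_ * _).
Qed.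

End projective_symmetric_norm_theory.

Section completion.
Context {R : realType} {k : scalar_kind}.
Local Notation F := (scalar_field R k).
Context {N : nat} {X : normedModType F} {Z : completeNormedModType F}.
Context (iota : {linear symtensor N X -> Z}).
Hypothesis iota_norm : forall u, `|iota u| = proj_sym_norm u.

Lemma norm_sum_sympow (n : nat) (lam : 'I_n -> F) (x : 'I_n -> X) :
  (forall i, `|x i| <= 1) ->
  `|\sum_i lam i *: iota (sympow (x i))| <= \sum_i `|lam i|.
Proof.
move=> x1; rewrite (le_trans (ler_norm_sum _ _ _))// ler_sum// => i _.
rewrite normrZ ler_piMr// iota_norm (le_trans (proj_sym_norm_sympow _))//.
by rewrite exprn_ile1.
Qed.

(** The weights of the random sets are nonnegative with sum 1, so the
    interpolation formula for the sum of increments bounds it by the sum of the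
    moduli of the interpolation weights, which depend on [N] only. *)
Lemma bounded_sum_increments : exists C : F, forall (I : finType) (x : X)
    (h : I -> X), (forall S : {set I}, `|x + \sum_(n in S) h n| <= 1) ->
  `|\sum_n (iota (sympow (x + h n)) - iota (sympow x))| <= C.
Proof.
have [c [t [t01 ctN]]] := linear_coef_interpolation F N.
exists (\sum_j `|c j|) => I x h xh.
under eq_bigr do rewrite -linearB; rewrite -linear_sum.
rewrite (sum_sympow_increments _ _ ctN) linear_sum.
rewrite (le_trans (ler_norm_sum _ _ _))// ler_sum// => j _.
rewrite linearZ normrZ ler_piMr// linear_sum.
rewrite -(sum_subset_weight (I := I) (t j)).
rewrite (le_trans (ler_norm_sum _ _ _))// ler_sum// => S _.
rewrite linearZ normrZ ger0_norm ?subset_weight_ge0// ler_piMr ?subset_weight_ge0//.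
by rewrite iota_norm (le_trans (proj_sym_norm_sympow _))// exprn_ile1.
Qed.

(** The increments of the given combination have bounded sums over every subset
    [B], as setting the modifications outside [B] to zero shows; hence one of
    them is weakly small. *)
Lemma weak_perturbation (p : nat) (lam : 'I_p -> F) (x : 'I_p -> X)
    (U : set (weak_space Z)) : open U ->
  U (\sum_i lam i *: iota (sympow (x i))) ->
  exists M : nat, forall x' : 'I_M -> 'I_p -> X,
    (forall i (S : {set 'I_M}), `|x i + \sum_(n in S) (x' n i - x i)| <= 1) ->
    exists n, U (\sum_i lam i *: iota (sympow (x' n i))).
Proof.
move=> oU Uz; have [J [f [e [e0 fU]]]] := weak_open_basis oU Uz.
have [C HC] := bounded_sum_increments.
have [M HM] := weakly_small_of_bounded_sums f (\sum_i `|lam i| * C) e0.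
exists M => x' x'1.
pose d n := \sum_i lam i *: (iota (sympow (x' n i)) - iota (sympow (x i))).
have [B|n dn] := HM d.
  rewrite /d exchange_big (le_trans (ler_norm_sum _ _ _))// ler_sum// => i _.
  rewrite -scaler_sumr normrZ ler_wpM2l//.
  pose h n := if n \in B then x' n i - x i else 0.
  rewrite big_mkcond (eq_bigr (fun n =>
      iota (sympow (x i + h n)) - iota (sympow (x i)))) => [|n _]; last first.
    by rewrite /h; case: ifP => _; rewrite ?addr0 ?subrr// [x i + _]addrC subrK.
  apply: HC => S; rewrite -big_mkcondr.
  rewrite (eq_bigl (fun n => n \in finset.setI S B)) => [|n]; first exact: x'1.
  by rewrite finset.in_setI.
exists n; apply: fU => j; rewrite distrC -linearB.
have -> // : \sum_i lam i *: iota (sympow (x' n i)) -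
   \sum_i lam i *: iota (sympow (x i)) = d n.
by rewrite -sumrB; apply: eq_bigr => i _; rewrite scalerBr.
Qed.

End completion.

(** * Local modification of continuous functions *)

Lemma disjoint_neighborhoods {K : topologicalType} (A : set K) (M : nat) :
  hausdorff_space K -> infinite_set A ->
  exists (s : 'I_M -> K) (U : 'I_M -> set K),
    (forall n, [/\ A (s n), open (U n) & U n (s n)]) /\
    forall n m y, U n y -> U m y -> n = m.
Proof.
rewrite open_hausdorff => hK Ainf; have [B BA MB] := infinite_set_fset M Ainf.
have [x0 _] : A !=set0.
  by apply/set0P/eqP => A0; apply: Ainf; rewrite A0; exact: finite_set0.
pose s (n : 'I_M) := nth x0 (enum_fset B) n.
have sB (n : 'I_M) : (n < size (enum_fset B))%N by rewrite (leq_trans _ MB).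
have s_inj n m : n != m -> s n != s m.
  by rewrite /s nth_uniq ?sB ?fset_uniq.
have /choice[V VP] : forall nm : 'I_M * 'I_M, exists V : set K * set K,
    nm.1 != nm.2 -> [/\ nbhs (s nm.1) V.1, nbhs (s nm.2) V.2 & V.1 `&` V.2 = set0].
  move=> [n m] /=; have [->|/s_inj/hK[V]] := eqVneq n m; first by exists (set0, set0).
  rewrite !inE => -[Vn Vm] [oV1 oV2 V0]; exists V => _.
  by split; [exact: open_nbhs_nbhs|exact: open_nbhs_nbhs|exact: V0].
pose W n := [set y | forall m, m != n -> (V (n, m)).1 y /\ (V (m, n)).2 y].
exists s, (fun n => (W n)^°); split=> [n|n m y /interior_subset Wn /interior_subset Wm].
  split; [by apply: BA; exact: mem_nth|exact: open_interior|].
  apply: filter_forall => m; have [->|mn] := eqVneq m n.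
    by apply: filterE.
  have nm : n != m by rewrite eq_sym.
  have [Vn _ _] := VP (n, m) nm.
  have [_ Vm _] := VP (m, n) mn.
  by apply: filterS2 Vn Vm => y.
apply/eqP; apply: contrapT => /negP nm.
have [_ _ V0] := VP (n, m) nm.
have mn : m != n by rewrite eq_sym.
have : (V (n, m)).1 `&` (V (n, m)).2 `<=` set0 by rewrite V0.
by move/(_ y); apply; split; [have [] := Wn m mn|have [] := Wm n nm].
Qed.

Lemma infinite_near_limit_point {K : topologicalType} (t : K) (O : set K) :
  hausdorff_space K -> limit_point [set: K] t -> nbhs t O -> infinite_set O.
Proof.
move=> hK tlim tO Ofin.
have /accessible_finite_set_closed/(_ (O `\ t)) clO := hausdorff_accessible hK.
have oO : open (~` (O `\ t)) by apply/closed_openC/clO/finite_setD.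
have [|y [yt _ [Oy]]] := tlim (O `&` ~` (O `\ t)).
  by apply: filterI => //; apply: open_nbhs_nbhs; split=> // -[_ /(_ erefl)].
by apply; split=> // /eqP; rewrite (negbTE yt).
Qed.

(** The inclusion of the reals in the scalar field; it makes the real-valued
    functions provided by Urysohn's lemma available as scalar functions. *)
Lemma real_embedding (R : realType) (k : scalar_kind) :
  exists2 j : R -> scalar_field R k, continuous j &
    [/\ j 0 = 0, j 1 = 1 & forall r, 0 <= r <= 1 -> 0 <= j r <= 1].
Proof.
case: k => /=; first by exists id => //; move=> x; exact: cvg_id.
exists (fun r => r%:C%C); last by split=> // r; rewrite !lecR.
move=> x; apply/(@cvgrPdist_lt _ R[i]^o) => e.
case: e => u v; rewrite ltcE /= => /andP[/eqP -> u0].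
have /cvgrPdist_lt/(_ u u0) : y @[y --> x] --> x by exact: cvg_id.
apply: filterS => y xy.
by rewrite -rmorphB /= normc_def /= expr0n addr0 sqrtr_sqr ltcR.
Qed.

Section continuous_function_space.
Context {R : realType} {k : scalar_kind} {K : topologicalType}.
Local Notation F := (scalar_field R k).
Context {cK : compact [set: K]}.
Hypothesis hK : hausdorff_space K.
Local Notation CK := (@cspace R k K cK).

Lemma cspace_normP (f : CK) (M : F) : 0 <= M ->
  `|f| <= M <-> forall y, `|f y| <= M.
Proof.
move=> M0; split=> [fM y|]; last exact: sup_norm_le.
by rewrite (le_trans _ fM)//; exact: sup_norm_ub.
Qed.

Lemma cspace_sumE (J : Type) (r : seq J) (P : pred J) (f : J -> CK) y :
  (\sum_(j <- r | P j) f j) y = \sum_(j <- r | P j) f j y.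
Proof.
exact: (big_morph (fun g : CK => g y : F)).
Qed.

(** With [g] an Urysohn function equal to [0] at [s] and to [1] off [U], take the
    pointwise convex combination of [x] and [c] with weights [g] and [1 - g]. *)
Lemma cspace_perturb (x : CK) (c : F) (s : K) (U : set K) : `|x| <= 1 ->
  `|c| <= 1 -> open U -> U s ->
  exists x' : CK, [/\ `|x'| <= 1, x' s = c & forall y, ~ U y -> x' y = x y].
Proof.
move=> x1 c1 oU Us.
have reg := normal_completely_regular (R := R) (compact_normal hK cK)
  (hausdorff_accessible hK).
have [|f [cf f01 fs fU]] := (uniform_separatorP (R := R) [set s] (~` U)).1.
  by apply: reg; [exact: open_closedC|move=> /(_ Us)].
have [j cj [j0 j1 j01]] := real_embedding R k.
pose g y : F := j (f y).
have g01 y : 0 <= g y <= 1.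
  by apply: j01; have /f01 : range f (f y) by exists y; rewrite /= ?in_itv.
have cg : continuous g by move=> y; apply: continuous_comp; [exact: cf|exact: cj].
pose h : K -> F^o := fun y => g y * x y + (1 - g y) * c.
have ch : h \in @cfun_pred R k K.
  apply/asboolP => y; apply: (@cvgD _ F^o).
    by apply: (@cvgM F); [exact: cg|exact: cspace_continuous].
  apply: (@cvgM F); last exact: cvg_cst.
  by apply: (@cvgB _ F^o); [exact: cvg_cst|exact: cg].
have g0 : g s = 0.
  by rewrite /g (_ : f s = 0)//; apply: fs; exists s.
have g1 y : ~ U y -> g y = 1.
  by move=> Uy; rewrite /g (_ : f y = 1)//; apply: fU; exists y.
exists (Cspace cK ch); split=> /=.
- apply/cspace_normP => // y /=; have /andP[gy0 gy1] := g01 y.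
  rewrite (le_trans (ler_normD _ _))// !normrM.
  rewrite (ger0_norm gy0) (@ger0_norm _ (1 - g y)) ?subr_ge0//.
  rewrite -[leRHS](subrK (g y)) [leLHS]addrC lerD//.
    by rewrite ler_piMr// ?subr_ge0.
  by rewrite ler_piMr//; apply: (cspace_normP x ler01).1.
- by rewrite /h g0 mul0r add0r subr0 mul1r.
- by move=> y /g1 gy; rewrite /h gy subrr mul0r addr0 mul1r.
Qed.

(** At each point the sum equals [x] or one of the [x' n], since the modifications
    do not overlap. *)
Lemma norm_glue (M : nat) (U : 'I_M -> set K) (x : CK) (x' : 'I_M -> CK)
    (S : {set 'I_M}) :
  (forall n m y, U n y -> U m y -> n = m) -> `|x| <= 1 ->
  (forall n, `|x' n| <= 1) -> (forall n y, ~ U n y -> x' n y = x y) ->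
  `|x + \sum_(n in S) (x' n - x)| <= 1.
Proof.
move=> Udisj /(cspace_normP _ ler01) x1 x'1 x'U; apply/cspace_normP => // y.
have -> : (x + \sum_(n in S) (x' n - x)) y = x y + \sum_(n in S) (x' n y - x y).
  exact: (congr1 (+%R (x y)) (cspace_sumE _ _ (fun n => x' n - x) y)).
have [[n [nS Uy]]|H] := pselect (exists n, n \in S /\ U n y).
  rewrite (bigD1 n)//= big1 => [|m /andP[_ mn]]; last first.
    by rewrite x'U ?subrr// => /(Udisj _ _ _ Uy) nm; rewrite nm eqxx in mn.
  by rewrite addr0 addrC subrK; apply: (cspace_normP _ ler01).1.
rewrite big1 ?addr0// => n nS; rewrite x'U ?subrr// => Uy.
by apply: H; exists n.
Qed.

End continuous_function_space.

Section perturbation.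
Context {R : realType} {k : scalar_kind} {K : topologicalType}.
Local Notation F := (scalar_field R k).
Context {cK : compact [set: K]}.
Hypothesis hK : hausdorff_space K.
Local Notation CK := (@cspace R k K cK).
Context {N : nat} {Z : completeNormedModType F} (iota : {linear symtensor N CK -> Z}).
Hypothesis iota_norm : forall u, `|iota u| = proj_sym_norm u.

(** [P s x'] records the values to be imposed on the modified family;
    the hypothesis says that modifications inside an arbitrary neighborhood of
    [s] achieve them, for every [s] in [A]. Applying it in disjoint
    neighborhoods of many points of [A], one of the resulting modifications is
    weakly small. *)
Lemma local_weak_perturbation (p : nat) (lam : 'I_p -> F) (x : 'I_p -> CK)
    (U : set (weak_space Z)) (A : set K) (P : K -> ('I_p -> CK) -> Prop) :
  (forall i, `|x i| <= 1) -> open U ->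
  U (\sum_i lam i *: iota (sympow (x i))) -> infinite_set A ->
  (forall s O, A s -> open O -> O s -> exists x' : 'I_p -> CK,
    [/\ forall i, `|x' i| <= 1, forall i y, ~ O y -> x' i y = x i y & P s x']) ->
  exists s x', [/\ A s, forall i, `|x' i| <= 1, P s x' &
    U (\sum_i lam i *: iota (sympow (x' i)))].
Proof.
move=> x1 oU Ux Ainf H.
have [M HM] := weak_perturbation iota_norm oU Ux.
have [s [V [sV Vdisj]]] := disjoint_neighborhoods M hK Ainf.
have /choice[x' x'P] : forall n, exists x' : 'I_p -> CK,
    [/\ forall i, `|x' i| <= 1, forall i y, ~ V n y -> x' i y = x i y & P (s n) x'].
  by move=> n; have [As oV Vs] := sV n; exact: H.
have [i B|n Uxn] := HM x'.
  apply: (norm_glue (x' := fun n => x' n i) _ Vdisj) => [//|n|n y].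
    by have [x'1 _ _] := x'P n; exact: x'1.
  by have [_ x'V _] := x'P n; exact: x'V.
exists (s n), (x' n); have [x'1 _ Px'] := x'P n.
by split=> //; have [] := sV n.
Qed.

End perturbation.

(** * The diameter two property *)

(** Normalize the [x i] by homogeneity and add the missing mass as a multiple of
    the tensor power of [0], which vanishes because [0 < N]. *)
Lemma symtensor_convex_representation {R : realType} {k : scalar_kind} {N : nat}
    {X : normedModType (scalar_field R k)} (u : symtensor N X) : (0 < N)%N ->
  proj_sym_norm u < 1 ->
  exists (p : nat) (lam : 'I_p -> scalar_field R k) (x : 'I_p -> X),
    [/\ u = \sum_i lam i *: sympow (x i), forall i, `|x i| <= 1 &
        \sum_i `|lam i| = 1].
Proof.
move=> N0 /proj_sym_norm_lt[n [lam [x [/symtensor_valE uE r1]]]].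
set r := \sum_i _ in r1.
pose lam1 i := lam i * `|x i| ^+ N; pose x1 i := `|x i|^-1 *: x i.
(* Index [ord0] carries the missing mass. *)
pose lam' i := if unlift ord0 i is Some j then lam1 j else 1 - r.
pose x' i := if unlift ord0 i is Some j then x1 j else 0.
have sympow0 : sympow 0 = 0 :> symtensor N X.
  by rewrite -(scale0r (0 : X)) sympowZ expr0n gtn_eqF// scale0r.
exists n.+1, lam', x'; split=> [|i|].
- rewrite big_ord_recl {1}/x' unlift_none sympow0 scaler0 add0r uE.
  apply: eq_bigr => i _; rewrite /lam' /x' liftK /lam1 /x1 sympowZ scalerA.
  have [->|x0] := eqVneq (x i) 0; first by rewrite sympow0 !scaler0.
  by rewrite -mulrA -exprMn mulfV ?normr_eq0// expr1n mulr1.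
- rewrite /x'; case: unlift => [j|]; last by rewrite normr0.
  rewrite /x1 normrZ normfV normr_id.
  have [->|x0] := eqVneq (x j) 0; first by rewrite normr0 mulr0.
  by rewrite mulVf// normr_eq0.
rewrite big_ord_recl {1}/lam' unlift_none ger0_norm ?subr_ge0 ?ltW//.
rewrite (_ : \sum_(i < n) _ = r) ?subrK//; apply: eq_bigr => i _.
by rewrite /lam' liftK normrM normrX normr_id.
Qed.

Section weak_topology_norm.
Context {R : realType} {k : scalar_kind}.
Local Notation F := (scalar_field R k).
Context {Z : normedModType F}.

Lemma weak_open_norm_open (U : set (weak_space Z)) : open U -> open (U : set Z).
Proof.
move=> oU; rewrite openE => z Uz; have [J [f [e [e0 fU]]]] := weak_open_basis oU Uz.
suff : \forall w \near z, forall j, `|sval (f j) z - sval (f j) w| < e j.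
  by apply: filterS.
apply: filter_forall => j.
have : sval (f j) w @[w --> z] --> (sval (f j) z : F) by exact: (svalP (f j)).
by move/cvgrPdist_lt => /(_ _ (e0 j)).
Qed.

(** Shrink [z] slightly: weakly open sets are open in norm. *)
Lemma weak_open_lt1 (U : set (weak_space Z)) (z : Z) :
  open U -> U z -> `|z| <= 1 ->
  exists2 w : Z, U w & `|w| < 1.
Proof.
move=> /weak_open_norm_open oU Uz z1.
have : \forall a \near (1 : F), U (a *: z).
  have : a *: z @[a --> (1 : F)] --> z.
    by have := @scalel_continuous F Z z 1; rewrite /continuous_at scale1r.
  by apply; apply: open_nbhs_nbhs.
move=> /nbhs_ballP[e /= e0 eU].
pose h := e / (e + 1); have e1 : 0 < e + 1 by rewrite addr_gt0.
have h0 : 0 < h by rewrite divr_gt0.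
have h1 : h < 1 by rewrite ltr_pdivrMr// mul1r ltrDl.
exists ((1 - h) *: z).
  apply: eU; rewrite /ball /= opprB addrC subrK gtr0_norm//.
  by rewrite ltr_pdivrMr// ltr_pMr// ltrDr.
rewrite normrZ gtr0_norm ?subr_gt0// (le_lt_trans (ler_piMr _ z1)) ?subr_ge0 ?(ltW h1)//.
by rewrite ltrBlDr ltrDl.
Qed.

Lemma diameter_two (V : set Z) (z : Z) : V `<=` unit_ball (Z := Z) -> V z ->
  (forall e : F, 0 < e -> exists2 y, V y & 2 - e <= `|z - y|) ->
  supremum 0 [set `|z - y| | y in V] = 2.
Proof.
move=> V1 Vz He; have [||| ub lb] := @scalar_supremumP R k [set `|z - y| | y in V].
- by exists `|z - z|, z.
- by move=> _ [y _ <-].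
- exists 2 => _ [y Vy <-]; rewrite (le_trans (ler_normB _ _))//.
  by rewrite (mulr2n 1) lerD//; apply: V1.
apply/eqP; rewrite eq_le; apply/andP; split.
  apply: lb => _ [y Vy <-]; rewrite (le_trans (ler_normB _ _))//.
  by rewrite (mulr2n 1) lerD//; apply: V1.
apply/ler_addgt0Pr => e e0; have [y Vy ey] := He e e0.
by rewrite -lerBlDr (le_trans ey)//; apply: ub; exists y.
Qed.

End weak_topology_norm.

Section point_evaluation_form.
Context {R : realType} {k : scalar_kind} {K : topologicalType}.
Local Notation F := (scalar_field R k).
Context {cK : compact [set: K]}.
Local Notation CK := (@cspace R k K cK).
Context {N : nat} (i0 : 'I_N) (t s : K).

Definition eval_form (v : 'I_N -> CK) : F^o :=
  \prod_i (v i (if i == i0 then s else t) : F).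

Lemma eval_form_multilinear : multilinear eval_form.
Proof.
move=> v i a x y; rewrite /eval_form.
have E u : \prod_j (subst_arg v i u j (if j == i0 then s else t) : F) =
    (u (if i == i0 then s else t) : F) *
    \prod_(j | j != i) (v j (if j == i0 then s else t) : F).
  rewrite (bigD1 i)//= /subst_arg eqxx; congr (_ * _).
  by apply: eq_bigr => j /negbTE ->.
by rewrite !E mulrDl -mulrA.
Qed.

Definition eval_multiform : multiform N CK := exist _ eval_form eval_form_multilinear.

Lemma eval_form_le (x : CK) : `|eval_form (fun=> x)| <= `|x| ^+ N.
Proof.
rewrite /eval_form normr_prod -[in leRHS](card_ord N) -prodr_const ler_prod// => i _.
by rewrite normr_ge0; exact: sup_norm_ub.
Qed.

(** All the factors but one are evaluations at [t], hence equal to 1. *)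
Lemma eval_form_at1 (x : CK) : x t = 1 -> eval_form (fun=> x) = x s.
Proof.
move=> xt; rewrite /eval_form (bigD1 i0)//= eqxx big1 ?mulr1// => i /negbTE ->.
exact: xt.
Qed.

End point_evaluation_form.

Theorem theorem3p15 (R : realType) (k : scalar_kind) (K : topologicalType)
    (cK : compact [set: K]) (hK : hausdorff_space K) (N : nat) (N_gt0 : (0 < N)%N)
    (K'_infinite : infinite_set (limit_point [set: K]))
    (Z : completeNormedModType (scalar_field R k))
    (iota : {linear symtensor N (cspace k cK) -> Z})
    (Z_completion : is_completion (@proj_sym_norm _ N (cspace k cK)) iota) :
  weak_DD2P Z.
Proof.
have [iota_norm iota_dense] := Z_completion.
move=> W [U oU ->] [z0 [Uz0 z01]].
have [w [[Uw w1] [u _ uw]]] : (U `&` ball_ Num.norm 0 1) `&` range iota !=set0.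
  apply: iota_dense; last first.
    by rewrite ball_normE; exact: openI (weak_open_norm_open oU) (ball_open _ _).
  have [w Uw w1] := weak_open_lt1 oU Uz0 z01; exists w; split=> //.
  by rewrite /ball_ /= sub0r normrN.
rewrite -{w}uw in Uw w1; rewrite /ball_ /= sub0r normrN iota_norm in w1.
have [p [lam [x [uE x1 lam1]]]] := symtensor_convex_representation N_gt0 w1.
rewrite uE linear_sum in Uw.
(* The phases which turn every [lam i] into its modulus. *)
pose c i := if lam i == 0 then 1 else `|lam i| / lam i.
have c1 i : `|c i| = 1.
  rewrite /c; case: eqVneq => [_|l0]; first by rewrite normr1.
  by rewrite normrM normfV normr_id mulfV// normr_eq0.
have lamc i : lam i * c i = `|lam i|.
  rewrite /c; case: eqVneq => [->|l0]; first by rewrite normr0 mul0r.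
  by rewrite mulrC divfK.
have {}Uw : U (\sum_i lam i *: iota (sympow (x i))).
  move: Uw; congr U; apply: eq_bigr => i _; exact: linearZ.
have hT1 := hausdorff_accessible hK.
have open_away (V : set K) (t : K) : open V -> open (V `\ t).
  by move=> oV; rewrite setDE; apply/(openI oV)/closed_openC/accessible_closed_set1.
(* The cluster point [t2] is not isolated, so [t1] can be taken in the same small
   neighborhood. *)
have [|t2 [x' [t2lim x'1 [t1 [t12 x't1 x't2]] Ux']]] :=
  local_weak_perturbation hK iota_norm (P := fun t2 x' => exists t1 : K,
    [/\ t1 != t2, forall i, x' i t1 = 1 & forall i, x' i t2 = c i]) x1 oU Uw K'_infinite.
  move=> s V slim oV Vs.
  have [t [ts _ Vt]] := slim V (open_nbhs_nbhs (conj oV Vs)).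
  have /choice[y yP] : forall i, exists y : cspace k cK,
      [/\ `|y| <= 1, y t = 1, y s = c i & forall r, ~ V r -> y r = x i r].
    move=> i.
    have [|||y [y1 yt yV]] := cspace_perturb hK (c := 1) (s := t) (U := V `\ s) (x1 i).
    - by rewrite normr1.
    - exact: open_away.
    - by split=> //; apply/eqP.
    have [|||y' [y'1 y's y'V]] := cspace_perturb hK (c := c i) (s := s) (U := V `\ t) y1.
    - by rewrite c1.
    - exact: open_away.
    - by split=> //; apply/eqP; rewrite eq_sym.
    exists y'; split=> // [|r Vr]; first by rewrite y'V// => -[_ /(_ erefl)].
    by rewrite y'V ?yV// => -[].
  exists y; split=> [i|i r Vr|]; [by have [] := yP i|by have [_ _ _ yV] := yP i; exact: yV|].
  by exists t; split=> // i; have [] := yP i.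
pose z := \sum_i lam i *: iota (sympow (x' i)).
have z1 : `|z| <= 1 by rewrite -lam1; exact: norm_sum_sympow.
exists z; first by [].
move=> _ [U' oU' ->] [U'z _]; apply: diameter_two; [exact: subIsetr|by split|].
move=> e e0.
(* At the points of [A], the values of the [x' i] are still close to the phases
   [c i], while they can be changed without affecting the value at [t1]. *)
pose A := [set s | s != t1 /\ forall i, `|x' i s - c i| < e].
have Ainf : infinite_set A.
  apply: (infinite_near_limit_point hK t2lim); apply: filterI.
    have : open_nbhs t2 ([set: K] `\ t1).
      by split; [apply: open_away; exact: openT|split=> //; apply/eqP; rewrite eq_sym].
    by move=> /open_nbhs_nbhs; apply: filterS => s [_ /eqP].
  apply: filter_forall => i.
  have /cvgrPdist_lt/(_ e e0) := @cspace_continuous _ _ _ _ (x' i) t2.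
  by rewrite x't2; apply: filterS => s; rewrite distrC.
have [|s [y [[st1 As] y1 [yt1 ys] U'y]]] :=
  local_weak_perturbation hK iota_norm (P := fun s y =>
    (forall i, y i t1 = 1) /\ (forall i, y i s = - c i)) x'1 oU' U'z Ainf.
  move=> s V [st1 _] oV Vs.
  have /choice[y yP] : forall i, exists y : cspace k cK,
      [/\ `|y| <= 1, y t1 = 1, y s = - c i & forall r, ~ V r -> y r = x' i r].
    move=> i.
    have [|||y [y1 ys yV]] := cspace_perturb hK (c := - c i) (s := s) (U := V `\ t1) (x'1 i).
    - by rewrite normrN c1.
    - exact: open_away.
    - by split=> //; apply/eqP.
    exists y; split=> // [|r Vr]; first by rewrite yV// => -[_ /(_ erefl)].
    by rewrite yV// => -[].
  exists y; split=> [i|i r Vr|]; [by have [] := yP i|by have [_ _ _ yV] := yP i; exact: yV|].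
  by split=> i; have [] := yP i.
exists (\sum_i lam i *: iota (sympow (y i))).
  by split=> //; rewrite /unit_ball /= -lam1; exact: norm_sum_sympow.
pose d : symtensor N (cspace k cK) := \sum_i lam i *: (sympow (x' i) - sympow (y i)).
have -> : z - \sum_i lam i *: iota (sympow (y i)) = iota d.
  rewrite /z /d [RHS]linear_sum -sumrB; apply: eq_bigr => i _.
  by rewrite [RHS](linearZZ iota) (linearB iota) scalerBr.
rewrite iota_norm.
have le := proj_sym_norm_ge (A := eval_multiform (Ordinal N_gt0) t1 s) d (eval_form_le _ _ _).
apply: le_trans le.
have -> : symtensor_val d (eval_multiform (Ordinal N_gt0) t1 s) =
    \sum_i lam i * (x' i s + c i).
  rewrite /d -[symtensor_val _]/(val _) linear_sum fct_sumE; apply: eq_bigr => i _.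
  rewrite linearZ linearB /= [LHS]/(lam i * (_ - _)); congr (_ * _).
  rewrite [X in X - _](eval_form_at1 _ _ (x't1 i)) [X in _ - X](eval_form_at1 _ _ (yt1 i)).
  by rewrite ys opprK.
(* As [lam i * c i = `|lam i|], the main part is twice the total mass. *)
have -> : \sum_i lam i * (x' i s + c i) = 2 - \sum_i lam i * (c i - x' i s).
  rewrite (mulr2n 1) -lam1 -big_split -sumrB /=; apply: eq_bigr => i _.
  by rewrite -lamc; ring.
rewrite (le_trans _ (lerB_dist _ _))// normr_nat lerD2l lerN2.
rewrite (le_trans (ler_norm_sum _ _ _))// -[leRHS]mul1r -lam1 mulr_suml ler_sum// => i _.
by rewrite normrM ler_wpM2l// distrC ltW.
Qed.
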